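(* Let $0<p\le1$ and $0<q<\infty$. Let $U$ be a regular kernel on $\mathbb Z\times\mathbb Z$ and let $\{v_n\}_{n\in\mathbb Z},\{w_n\}_{n\in\mathbb Z}$ be sequences of nonnegative real numbers. Extend $U$ to $\mathbb R^2$ by $U(s,t)=\sum_{(i,n)\in\mathbb Z^2}U(i,n)\chi_{(i-1,i]\times(n-1,n]}(s,t)$ and put $v(t)=\sum_{n\in\mathbb Z}v_n\chi_{(n-1,n]}(t)$, $w(t)=\sum_{n\in\mathbb Z}w_n\chi_{(n-1,n]}(t)$ for $s,t\in\mathbb R$. (a) There is a constant $C$ such that $$\Big(\sum_{n\in\mathbb Z}\Big(\sum_{i=-\infty}^nU(i,n)a_i\Big)^qw_n\Big)^{1/q}\le C\Big(\sum_{n\in\mathbb Z}a_n^pv_n\Big)^{1/p}$$ for every sequence $\{a_n\}_{n\in\mathbb Z}$ of nonnegative real numbers if and only if there is a constant $C'$ such that $$\Big(\int_{-\infty}^\infty\Big(\int_{-\infty}^tU(s,t)^pf(s)\,ds\Big)^{q/p}w(t)\,dt\Big)^{p/q}\le C'\int_{-\infty}^\infty f(t)v(t)\,dt$$ for every nonnegative measurable function $f$ on $\mathbb R$. Moreover, if $C$ and $C'$ are the best constants, then $C\approx(C')^{1/p}$. (b) Similarly, there is a constant $C$ such that $$\Big(\sum_{n\in\mathbb Z}\Big(\sum_{i=n}^\infty U(n,i)a_i\Big)^qw_n\Big)^{1/q}\le C\Big(\sum_{n\in\mathbb Z}a_n^pv_n\Big)^{1/p}$$ for every sequence $\{a_n\}_{n\in\mathbb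 Z}$ of nonnegative real numbers if and only if there is a constant $C''$ such that $$\Big(\int_{-\infty}^\infty\Big(\int_t^\infty U(t,s)^pf(s)\,ds\Big)^{q/p}w(t)\,dt\Big)^{p/q}\le C''\int_{-\infty}^\infty f(t)v(t)\,dt$$ for every nonnegative measurable function $f$ on $\mathbb R$. Moreover, if $C$ and $C''$ are the best constants, then $C\approx(C'')^{1/p}$.
   Context: A function $U\colon\mathbb Z\times\mathbb Z\to[0,\infty)$ is a regular kernel if it is nonincreasing in the first variable, nondecreasing in the second variable, and there is a positive constant $c$ (the constant of regularity) with $U(i,n)\le c(U(i,j)+U(j,n))$ for all integers $i\le j\le n$. $A\approx B$ means $c_1A\le B\le c_2A$ with positive constants $c_1,c_2$ depending only on $p$, $q$ and the constant of regularity of $U$. Sums and integrals take values in $[0,\infty]$, with $0\cdot\infty=0$. *)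

(* Defs.v *)
From HB Require Import structures.
From mathcomp Require Export all_boot all_order all_algebra.
From mathcomp Require Export all_classical all_reals all_analysis.

Set Implicit Arguments.
Unset Strict Implicit.
Unset Printing Implicit Defensive.

Import Order.TTheory GRing.Theory Num.Theory.
Import numFieldNormedType.Exports.
Local Open Scope classical_set_scope.
Local Open Scope ring_scope.

Definition regular_kernel (R : realType) (c : R) (U : int -> int -> R) : Prop :=
  [/\ forall i n, 0 <= U i n,
      forall i j n, i <= j -> U j n <= U i n,
      forall i m n, m <= n -> U i m <= U i n,
      0 < c
    & forall i j n, i <= j -> j <= n -> U i n <= c * (U i j + U j n)].

Definition cell (R : realType) (n : int) : set R :=
  [set` `](n%:~R - 1), n%:~R]%R].
Arguments cell : clear implicits.

(* In both extensions at most one term of the finite-support sum is nonzero,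
   so it is never the default value 0 of a sum with infinite support; see
   step_fun1E and step_fun2E. *)
Definition step_fun1 (R : realType) (v : int -> R) (t : R) : R :=
  \sum_(n \in [set: int]) v n * \1_(cell R n) t.

Definition step_fun2 (R : realType) (U : int -> int -> R) (s t : R) : R :=
  \sum_(k \in [set: int * int])
    U k.1 k.2 * \1_(cell R k.1 `*` cell R k.2) (s, t).

Lemma in_cell (R : realType) (n : int) (t : R) :
  (t \in cell R n) = (n == Num.ceil t).
Proof.
rewrite eq_sym Num.Theory.ceil_eq intrD mulrNz.
by apply/idP/idP; rewrite inE /cell /= in_itv.
Qed.

Lemma step_fun1E (R : realType) (v : int -> R) (t : R) :
  step_fun1 v t = v (Num.ceil t).
Proof.
rewrite /step_fun1 -(@fsbig_widen _ _ _ _ [set Num.ceil t])//.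
  by rewrite fsbig_set1 indicE in_cell eqxx mulr1.
move=> n [_ /= /eqP nt]; rewrite indicE in_cell.
by rewrite (negbTE nt) mulr0.
Qed.

Lemma step_fun2E (R : realType) (U : int -> int -> R) (s t : R) :
  step_fun2 U s t = U (Num.ceil s) (Num.ceil t).
Proof.
rewrite /step_fun2 -(@fsbig_widen _ _ _ _ [set (Num.ceil s, Num.ceil t)])//.
  by rewrite fsbig_set1 indicE in_setX !in_cell !eqxx mulr1.
move=> [i n] [_ /= /eqP kst]; rewrite indicE in_setX !in_cell.
by move: kst; rewrite xpair_eqE => /negbTE ->; rewrite mulr0.
Qed.

Local Open Scope ereal_scope.

Definition discrete_lower (R : realType) (p q : R) (U : int -> int -> R)
    (v w : int -> R) (C : R) : Prop :=
  forall a : int -> R, (forall n, (0 <= a n)%R) ->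
    (\esum_(n in [set: int])
       ((\esum_(i in [set i : int | (i <= n)%R]) (U i n * a i)%:E) `^ q
        * (w n)%:E)) `^ q^-1
    <= C%:E * (\esum_(n in [set: int]) (a n `^ p * v n)%:E) `^ p^-1.

Definition discrete_upper (R : realType) (p q : R) (U : int -> int -> R)
    (v w : int -> R) (C : R) : Prop :=
  forall a : int -> R, (forall n, (0 <= a n)%R) ->
    (\esum_(n in [set: int])
       ((\esum_(i in [set i : int | (n <= i)%R]) (U n i * a i)%:E) `^ q
        * (w n)%:E)) `^ q^-1
    <= C%:E * (\esum_(n in [set: int]) (a n `^ p * v n)%:E) `^ p^-1.

Definition continuous_lower (R : realType) (p q : R) (U : int -> int -> R)
    (v w : int -> R) (C : R) : Prop :=
  forall f : R -> R, measurable_fun [set: R] f -> (forall t, (0 <= f t)%R) ->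
    (\int[lebesgue_measure]_(t in [set: R])
       ((\int[lebesgue_measure]_(s in [set` `]-oo, t]%R])
           (step_fun2 U s t `^ p * f s)%:E) `^ (q / p)
        * (step_fun1 w t)%:E)) `^ (p / q)
    <= C%:E * \int[lebesgue_measure]_(t in [set: R]) (f t * step_fun1 v t)%:E.

Definition continuous_upper (R : realType) (p q : R) (U : int -> int -> R)
    (v w : int -> R) (C : R) : Prop :=
  forall f : R -> R, measurable_fun [set: R] f -> (forall t, (0 <= f t)%R) ->
    (\int[lebesgue_measure]_(t in [set: R])
       ((\int[lebesgue_measure]_(s in [set` `[t, +oo[%R])
           (step_fun2 U t s `^ p * f s)%:E) `^ (q / p)
        * (step_fun1 w t)%:E)) `^ (p / q)
    <= C%:E * \int[lebesgue_measure]_(t in [set: R]) (f t * step_fun1 v t)%:E.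

(* The value is +oo when no finite constant is admissible. *)
Definition best_constant (R : realType) (P : R -> Prop) : \bar R :=
  ereal_inf [set C%:E | C in [set C : R | (0 <= C)%R /\ P C]].

(* Main.v *)
Require Import Defs.
From mathcomp Require Import all_boot all_order all_algebra.
From mathcomp Require Import all_classical all_reals all_analysis.
From mathcomp Require Import measurable_realfun.
From mathcomp Require Import ring lra zify.
Import Order.TTheory GRing.Theory Num.Theory.
Import numFieldNormedType.Exports.
Set Implicit Arguments.
Unset Strict Implicit.
Unset Printing Implicit Defensive.
Local Open Scope classical_set_scope.
Local Open Scope ring_scope.

(** Integrating [f] over the cells turns the inequality for functions, up to
    constants, into one for the sequence [F n] of the integrals of [f] over the
    cells, namely the inequality for sequences with the inner sum
    [\sum_i U i n * a i] replaced by [(\sum_i (U i n * a i) ^ p) ^ (1/p)],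
    where [F i = a i ^ p].  As [p <= 1], the second expression dominates the
    first, so the inequality for functions implies the one for sequences.
    The only loss comes from the cell which contains both variables; it is
    controlled by testing on functions that live on one half of each cell and
    integrating the outer variable over the other half
    ([sequence_of_function]).

    For the converse, an l^p sum has to be estimated by an l^1 sum, which is
    false for the same sequence but becomes true after moving mass: for every
    [a] there is [b] with [\sum b^p v <= 2 \sum a^p v] such that for every [n]
    [\sum_(i <= n) (U i n * a i)^p <= K (\sum_(i <= n) U i n * b i)^p],
    with [K] depending on [p] and [c] only.
    The reason is that the left-hand side [A n] is nondecreasing in [n], so up
    to a constant it only matters at the jump points [n_0 < n_1 < ...] where it
    has grown by a large factor [L] since the previous one.  Between two jump
    points, all the mass of [a] is concentrated at one index of the block, chosen
    so that the block sum is kept at the right end without increasing the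
    weighted norm (such an index exists by averaging); for a single index, l^p
    and l^1 agree ([greedy_concentration]).  What remains at [n_{k+1}] is the
    contribution of the indices up to [n_k].  By regularity it is at most
    [c^p A(n_k) + c^p U(n_k, n_{k+1})^p \sum_(i <= n_k) a i ^ p].  The first
    term is at most half of [A (n_{k+1})] for [L] large, and the second one
    is handled by the same construction for the kernel 1, because
    [U(n_k, n_{k+1}) <= U(i, n_{k+1})] for [i <= n_k]
    ([regular_concentration]).

    The construction is carried out for sequences supported in a finite window of
    indices, and for [n] in that window.  In general the [F n] are extended real
    numbers with arbitrary support, and the inequality for them follows by
    truncation ([power_inequality]).  The case of sums over [i >= n] follows
    by the same argument, after the reflection [i -> - i] for the sequences, which
    turns the kernel into [U (- n) (- i)]. *)

(** * Powers with exponent at most one *)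

Section Combinatorics.
Context {R : realType}.
Implicit Types (x y p : R).

Lemma le_powR_nneg p x y : 0 < p -> 0 <= x -> x <= y -> x `^ p <= y `^ p.
Proof.
move=> p0 x0 xy.
by apply: ge0_ler_powR => //; rewrite ?nnegrE ?(ltW p0)// (le_trans x0).
Qed.

Lemma powR_invK p x : p != 0 -> 0 <= x -> (x `^ p^-1) `^ p = x.
Proof. by move=> p0 x0; rewrite -powRrM mulVf// powRr1. Qed.

Lemma powR_subadd p x y : 0 < p -> p <= 1 -> 0 <= x -> 0 <= y ->
  (x + y) `^ p <= x `^ p + y `^ p.
Proof.
move=> p0 p1 x0 y0.
have [s0|s0] := eqVneq (x + y) 0.
  by rewrite s0 powR0 ?gt_eqF// addr_ge0 ?powR_ge0.
have sgt0 : 0 < x + y by rewrite lt_neqAle eq_sym s0 addr_ge0.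
have bd z : 0 <= z -> z <= x + y -> z / (x + y) * (x + y) `^ p <= z `^ p.
  rewrite le_eqVlt => /predU1P[<- _|z0 zs].
    by rewrite !mul0r powR_ge0.
  have -> : z `^ p = (z / (x + y)) `^ p * (x + y) `^ p.
    by rewrite -powRM ?divfK// ?(ltW sgt0)// divr_ge0 ?(ltW z0) ?(ltW sgt0).
  rewrite ler_wpM2r ?powR_ge0// ger1_powR//.
  by rewrite divr_gt0//= ler_pdivrMr// mul1r.
have := lerD (bd _ x0 _) (bd _ y0 _).
by rewrite -!mulrDl divff// mul1r; apply; rewrite ?lerDl ?lerDr.
Qed.

Lemma powR_sum_subadd p (I : Type) (r : seq I) (P : pred I) (f : I -> R) :
  0 < p -> p <= 1 -> (forall i, 0 <= f i) ->
  (\sum_(i <- r | P i) f i) `^ p <= \sum_(i <- r | P i) f i `^ p.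
Proof.
move=> p0 p1 f0.
suff: 0 <= \sum_(i <- r | P i) f i /\
  (\sum_(i <- r | P i) f i) `^ p <= \sum_(i <- r | P i) f i `^ p by case.
elim/big_rec2 : _ => [|i a b _ [b0 ba]]; first by rewrite powR0 ?gt_eqF.
split; first exact: addr_ge0.
by rewrite (le_trans (powR_subadd p0 p1 _ b0))// lerD2l.
Qed.

(** * Concentrating a sequence at the jumps of its power sums *)

(** Averaging: if no single index could carry the sum of [g * x] at a cost
    [y * v i] below the total cost, then
    [s * v i > V * g i] wherever [g i * x i > 0], with [s] and [V] the two
    sums; multiplying by [x i] and summing gives [s * V > V * s]. *)
Lemma concentrate_block (m N : nat) (g x v : nat -> R) :
  (m < N)%N -> (forall i, 0 <= g i) -> (forall i, 0 <= x i) ->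
  (forall i, 0 <= v i) ->
  exists i y, [/\ (m <= i < N)%N, 0 <= y,
    \sum_(m <= j < N) g j * x j <= g i * y &
    y * v i <= \sum_(m <= j < N) x j * v j].
Proof.
move=> mN g0 x0 v0.
set s := \sum_(m <= j < N) g j * x j; set V := \sum_(m <= j < N) x j * v j.
have s0 : 0 <= s by apply: sumr_ge0 => j _; rewrite mulr_ge0.
have V0 : 0 <= V by apply: sumr_ge0 => j _; rewrite mulr_ge0.
have [sz|snz] := eqVneq s 0.
  by exists m, 0; rewrite leqnn mN lexx sz mulr0 mul0r lexx V0.
have [[i [mi gx le]]|none] := pselect (exists i,
    [/\ (m <= i < N)%N, 0 < g i * x i & s * v i <= V * g i]).
  have gi : 0 < g i.
    by rewrite lt_neqAle eq_sym g0 andbT; apply: contraTneq gx => ->; rewrite mul0r ltxx.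
  exists i, (s / g i); split => //.
  - by rewrite divr_ge0.
  - by rewrite mulrC divfK ?gt_eqF.
  - by rewrite mulrAC ler_pdivrMr.
exfalso.
have tE i : x i * (s * v i - V * g i) = s * (x i * v i) - V * (g i * x i) by ring.
have gt i : (m <= i < N)%N -> 0 < g i * x i -> V * g i < s * v i.
  by move=> mi gx; rewrite ltNge; apply/negP => le; apply: none; exists i.
have ge i : (m <= i < N)%N -> 0 <= x i * (s * v i - V * g i).
  move=> mi; have := mulr_ge0 (g0 i) (x0 i).
  rewrite le_eqVlt => /predU1P[z|/(gt _ mi) lt].
    by rewrite tE -z mulr0 subr0 !mulr_ge0.
  by rewrite mulr_ge0// subr_ge0 ltW.
have tot : \sum_(m <= i < N) x i * (s * v i - V * g i) = 0.
  by under eq_bigr do rewrite tE; rewrite sumrB -!mulr_sumr mulrC subrr.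
suff [i mi gx] : exists2 i, (m <= i < N)%N & 0 < g i * x i.
  have iin : i \in index_iota m N by rewrite mem_index_iota.
  move: tot; rewrite (big_rem i)//=; apply/eqP; rewrite gt_eqF// ltr_pwDl//.
    rewrite mulr_gt0 ?subr_gt0 ?gt// lt_neqAle eq_sym x0 andbT.
    by apply: contraTneq gx => ->; rewrite mulr0 ltxx.
  rewrite big_seq sumr_ge0// => j /mem_rem; rewrite mem_index_iota; exact: ge.
apply: contrapT => nex; move/eqP: snz; apply; rewrite /s big_nat.
rewrite big1// => i mi; apply: le_anti; rewrite mulr_ge0// andbT leNgt.
by apply/negP => gx; apply: nex; exists i.
Qed.

(** The bound [k] is exclusive, so the kernel is evaluated at [k.-1], the last
    index of the sum. *)
Definition powsum (p : R) (U : nat -> nat -> R) (a : nat -> R) (k : nat) : R :=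
  \sum_(0 <= i < k) (U i k.-1 * a i) `^ p.

Definition linsum (U : nat -> nat -> R) (b : nat -> R) (k : nat) : R :=
  \sum_(0 <= i < k) U i k.-1 * b i.

Lemma linsum_ge0 (U : nat -> nat -> R) (b : nat -> R) k :
  (forall i n, 0 <= U i n) -> (forall i, 0 <= b i) -> 0 <= linsum U b k.
Proof. by move=> U0 b0; apply: sumr_ge0 => i _; rewrite mulr_ge0. Qed.

Lemma powsum_ge0 p (U : nat -> nat -> R) (a : nat -> R) k : 0 <= powsum p U a k.
Proof. by apply: sumr_ge0 => i _; rewrite powR_ge0. Qed.

Lemma ler_linsum (U : nat -> nat -> R) (a b : nat -> R) k l :
  (forall i n, 0 <= U i n) ->
  (forall i m n, (m <= n)%N -> U i m <= U i n) ->
  (k <= l)%N -> (forall i, 0 <= a i) -> (forall i, a i <= b i) ->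
  linsum U a k <= linsum U b l.
Proof.
move=> U0 Ur kl a0 ab.
rewrite /linsum (big_cat_nat (leq0n k) kl)//= -[leLHS]addr0 lerD//.
  by apply: ler_sum => i _; apply: ler_pM => //; apply: Ur; rewrite -!subn1 leq_sub2r.
by apply: sumr_ge0 => i _; rewrite mulr_ge0// (le_trans (a0 i)).
Qed.

(** In the conclusion, [j] is the last jump point not after [n] and [k] the jump
    point preceding it.  The block from [k] to [j] is concentrated at one index
    of [b], hence is controlled by the last [linsum]; what precedes the block is
    left to be estimated with the help of [L * powsum p U a k <= powsum p U a j].
    The induction on [N] remembers the last jump point [m] and a [b] supported
    below it: mass is added only when a new jump occurs, and then at an index not
    before [m], where [b] still vanishes. *)
Lemma greedy_concentration (p L : R) (U : nat -> nat -> R)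
    (a v : nat -> R) (N : nat) :
  0 < p -> 1 <= L -> (forall i n, 0 <= U i n) ->
  (forall i m n, (m <= n)%N -> U i m <= U i n) ->
  (forall i, 0 <= a i) -> (forall i, 0 <= v i) ->
  exists b : nat -> R, [/\ forall i, 0 <= b i,
    forall i, (N <= i)%N -> b i = 0,
    \sum_(0 <= i < N) b i `^ p * v i <= \sum_(0 <= i < N) a i `^ p * v i &
    forall n, (n <= N)%N -> exists k j, [/\ (k <= j <= n)%N,
      powsum p U a n <= L * powsum p U a j,
      L * powsum p U a k <= powsum p U a j &
      powsum p U a j <= \sum_(0 <= i < k) (U i j.-1 * a i) `^ p
                        + linsum U b j `^ p]].
Proof.
move=> p0 L0 U0 Ur a0 v0.
pose jump b j := exists2 k, (k <= j)%N &
   L * powsum p U a k <= powsum p U a j /\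
   powsum p U a j <= \sum_(0 <= i < k) (U i j.-1 * a i) `^ p
                        + linsum U b j `^ p.
suff [b [m [[mN b0 bm] bv Nm jm jn]]] : exists (b : nat -> R) m, [/\
    [/\ (m <= N)%N, forall i, 0 <= b i & forall i, (m <= i)%N -> b i = 0],
    \sum_(0 <= i < m) b i `^ p * v i <= \sum_(0 <= i < m) a i `^ p * v i,
    powsum p U a N <= L * powsum p U a m, jump b m &
    forall n, (n <= N)%N -> exists2 j, (j <= n)%N &
      powsum p U a n <= L * powsum p U a j /\ jump b j].
  exists b; split => //.
  - by move=> i Ni; apply: bm; apply: leq_trans Ni.
  - rewrite !(big_cat_nat (leq0n m) mN)//= lerD//.
    rewrite big_nat big1 => [|i /andP[mi _]].
      by apply: sumr_ge0 => i _; rewrite mulr_ge0 ?powR_ge0.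
    by rewrite bm// powR0 ?mul0r// gt_eqF.
  - move=> n /jn[j jn' [Hj [k kj [H1 H2]]]]; exists k, j; split => //.
    by rewrite kj.
have H0 : powsum p U a 0 = 0 by rewrite /powsum big_geq.
have L00 : 0 <= L by rewrite (le_trans _ L0).
elim: N => [|N [b [m [[mN b0 bm] bv Nm jm jn]]]].
  have j0 : jump (fun=> 0) 0%N.
    by exists 0%N => //; rewrite H0 mulr0 lexx big_geq// add0r powR_ge0.
  exists (fun=> 0), 0%N; split => //.
  - by rewrite !big_geq.
  - by rewrite H0 mulr0.
  - move=> n; rewrite leqn0 => /eqP ->; exists 0%N => //; split => //.
    by rewrite H0 mulr0.
(* Either [N.+1] is not a jump point and nothing changes, or the block from [m]
   to [N] is concentrated at an index [i]. *)
have [small|big] := lerP (powsum p U a N.+1) (L * powsum p U a m).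
  exists b, m; split => //; first by split => //; exact: leqW.
  move=> n; rewrite leq_eqVlt => /predU1P[->|]; last exact: jn.
  by exists m => //; exact: leqW.
have [i [y [miN y0 le_g le_v]]] := @concentrate_block m N.+1
  (fun i => U i N `^ p) (fun i => a i `^ p) v mN
  (fun i => powR_ge0 _ _) (fun i => powR_ge0 _ _) v0.
have bi : b i = 0 by apply: bm; case/andP: miN.
pose b' j := if j == i then y `^ p^-1 else b j.
have bb' j : b j <= b' j.
  by rewrite /b'; case: eqP => [->|//]; rewrite bi powR_ge0.
have b'0 j : 0 <= b' j := le_trans (b0 j) (bb' j).
have jump_mono j : jump b j -> jump b' j.
  move=> [k kj [H1 H2]]; exists k => //; split => //.
  rewrite (le_trans H2)// lerD2l le_powR_nneg// ?linsum_ge0//.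
  exact: ler_linsum.
have jN : jump b' N.+1.
  exists m; first exact: leqW.
  split; first exact: ltW.
  rewrite {1}/powsum (big_cat_nat (leq0n m) (leqW mN))//= lerD2l.
  under eq_bigr do rewrite powRM//.
  rewrite (le_trans le_g)// -[y in leLHS](@powR_invK p) ?gt_eqF//.
  rewrite -powRM ?powR_ge0// le_powR_nneg// ?mulr_ge0 ?powR_ge0//.
  have iin : i \in index_iota 0 N.+1 by rewrite mem_index_iota; case/andP: miN.
  rewrite /linsum (big_rem i)//= /b' eqxx lerDl.
  by apply: sumr_ge0 => j _; rewrite mulr_ge0// b'0.
exists b', N.+1; split => //.
- split => // j Nj; rewrite /b'; case: eqP => [ji|_].
    by move: miN; rewrite -ji; lia.
  by apply: bm; lia.
- rewrite !(big_cat_nat (leq0n m) (leqW mN))//= lerD//.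
    rewrite (le_trans _ bv)// big_nat [leRHS]big_nat ler_sum// => j jm'.
    by rewrite /b'; case: eqP => // ji; move: miN; rewrite -ji; lia.
  rewrite (le_trans _ le_v)// (big_rem i) ?mem_index_iota//= /b' eqxx.
  rewrite powR_invK ?gt_eqF// big_seq big1 ?addr0// => j.
  rewrite mem_rem_uniq ?iota_uniq// inE mem_index_iota => /andP[ji mj].
  by rewrite (negbTE ji) bm ?powR0 ?mul0r ?gt_eqF//; case/andP: mj.
- by rewrite ler_peMl// powsum_ge0.
- move=> n; rewrite leq_eqVlt => /predU1P[->|].
    by exists N.+1 => //; split => //; rewrite ler_peMl// powsum_ge0.
  by move=> /jn[j jn' [H1 H2]]; exists j => //; split => //; exact: jump_mono.
Qed.
End Combinatorics.

(** * Concentration for regular kernels *)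

(** The factor [L] between jumps exceeds [2 * c `^ p], so that [c `^ p] times the
    previous power sum is at most half of the current one. *)
Definition compression_const {R : realType} (p c : R) : R :=
  let L := 2 * c `^ p + 2 in 2 * L * (c `^ p * (2 * L) + 1).

Lemma compression_const_gt0 {R : realType} (p c : R) : 0 < compression_const p c.
Proof.
have := powR_ge0 c p; rewrite /compression_const /=.
by move=> cp; rewrite !mulr_gt0// ?ltr_wpDl// !mulr_ge0// addr_ge0// mulr_ge0.
Qed.

(** Regularity splits the sum over the indices before the jump point [k] into the
    previous power sum, absorbed into the left-hand side by the choice of [L],
    and a multiple of [\sum_(i < k) a i `^ p], which is treated by the greedy
    construction for the constant kernel 1; [b] is the sum of the two sequences
    obtained. *)
Lemma regular_concentration {R : realType} (p c : R) (U : nat -> nat -> R)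
    (a v : nat -> R) (N : nat) :
  0 < p -> p <= 1 -> 0 < c ->
  (forall i n, 0 <= U i n) ->
  (forall i j n, (i <= j)%N -> U j n <= U i n) ->
  (forall i m n, (m <= n)%N -> U i m <= U i n) ->
  (forall i j n, (i <= j)%N -> (j <= n)%N -> U i n <= c * (U i j + U j n)) ->
  (forall i, 0 <= a i) -> (forall i, 0 <= v i) ->
  exists b : nat -> R, [/\ forall i, 0 <= b i,
    \sum_(0 <= i < N) b i `^ p * v i <= 2 * \sum_(0 <= i < N) a i `^ p * v i &
    forall n, (n <= N)%N ->
      powsum p U a n <= compression_const p c * linsum U b n `^ p].
Proof.
move=> p0 p1 c0 U0 Ul Ur Uq a0 v0.
pose L := 2 * c `^ p + 2.
have cp0 := powR_ge0 c p.
have L1 : 1 <= L by rewrite /L; lra.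
have L0 : 0 <= L by lra.
have [b1 [b10 _ b1v Hb1]] := @greedy_concentration R p L (fun _ _ => 1) a v N p0 L1
  (fun _ _ => ler01) (fun _ _ _ _ => lexx _) a0 v0.
have [b2 [b20 _ b2v Hb2]] := @greedy_concentration R p L U a v N p0 L1 U0 Ur a0 v0.
pose S k : R := \sum_(0 <= i < k) a i `^ p.
have SE k : \sum_(0 <= i < k) (1 * a i) `^ p = S k.
  by apply: eq_bigr => i _; rewrite mul1r.
have linE k : linsum (fun _ _ => 1) b1 k = \sum_(0 <= i < k) b1 i.
  by apply: eq_bigr => i _; rewrite mul1r.
have S_le n : (n <= N)%N -> S n <= 2 * L * (\sum_(0 <= i < n) b1 i) `^ p.
  move=> /Hb1 [k [j [/andP[kj jn]]]]; rewrite /powsum !SE linE => H1 H2 H3.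
  rewrite (le_trans H1)// [2 * L]mulrC -mulrA ler_wpM2l//.
  have {}H3 : S j <= 2 * (\sum_(0 <= i < j) b1 i) `^ p.
    have SL : 2 * S k <= S j.
      rewrite (le_trans _ H2)// ler_wpM2r//.
        by apply: sumr_ge0 => i _; exact: powR_ge0.
      by rewrite /L; lra.
    lra.
  rewrite (le_trans H3)// ler_wpM2l// le_powR_nneg//.
    exact: sumr_ge0.
  by rewrite [leRHS](big_cat_nat (leq0n j) jn)//= lerDl sumr_ge0.
exists (fun i => b1 i + b2 i); split.
- by move=> i; rewrite addr_ge0.
- rewrite mulr_natl mulr2n (le_trans _ (lerD b1v b2v))// -big_split/=.
  by apply: ler_sum => i _; rewrite -mulrDl ler_wpM2r// powR_subadd.
move=> n nN; have [k [j [/andP[kj jn] H1 H2 H3]]] := Hb2 _ nN.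
pose B := linsum U (fun i => b1 i + b2 i) j.
have b120 i : 0 <= b1 i + b2 i by rewrite addr_ge0.
have B0 : 0 <= B by exact: linsum_ge0.
(* The sum before the last block. *)
have T_le : \sum_(0 <= i < k) (U i j.-1 * a i) `^ p <=
    c `^ p * powsum p U a k + c `^ p * (2 * L) * B `^ p.
  case: k kj H2 H3 => [|k] kj H2 H3.
    rewrite big_geq// addr_ge0// ?mulr_ge0// ?powR_ge0//.
    exact: powsum_ge0.
  apply: (@le_trans _ _ (c `^ p * (powsum p U a k.+1 + U k j.-1 `^ p * S k.+1))).
    rewrite /powsum /S mulr_sumr -big_split mulr_sumr /=.
    rewrite big_nat [leRHS]big_nat; apply: ler_sum => i /andP[_ ik].
    rewrite -!powRM// ?mulr_ge0//.
    rewrite (@le_trans _ _ ((c * (U i k * a i + U k j.-1 * a i)) `^ p))//.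
      rewrite le_powR_nneg ?mulr_ge0// -mulrDl mulrA ler_wpM2r// Uq//; lia.
    rewrite powRM ?(ltW c0) ?addr_ge0 ?mulr_ge0// ler_wpM2l//.
    by rewrite powR_subadd ?mulr_ge0.
  rewrite mulrDr lerD2l -mulrA ler_wpM2l//.
  apply: (@le_trans _ _ (U k j.-1 `^ p * (2 * L * (\sum_(0 <= i < k.+1) b1 i) `^ p))).
    by rewrite ler_wpM2l ?powR_ge0// S_le; lia.
  rewrite mulrCA ler_wpM2l ?mulr_ge0// -powRM ?sumr_ge0//.
  rewrite le_powR_nneg ?mulr_ge0 ?sumr_ge0//.
  rewrite /B /linsum (big_cat_nat (leq0n k.+1) kj)//= mulr_sumr -[leLHS]addr0.
  rewrite lerD//; last by apply: sumr_ge0 => i _; rewrite mulr_ge0.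
  rewrite [leLHS]big_nat [leRHS]big_nat ler_sum// => i /andP[_ ik].
  by rewrite ler_pM// ?lerDl// Ul.
have b2B : linsum U b2 j `^ p <= B `^ p.
  rewrite le_powR_nneg ?linsum_ge0// ler_linsum// => i.
  by rewrite lerDr.
have half : c `^ p * powsum p U a k <= 2^-1 * powsum p U a j.
  have := powsum_ge0 p U a k; move: H2; rewrite /L; nra.
have Bn : B `^ p <= linsum U (fun i => b1 i + b2 i) n `^ p.
  by rewrite le_powR_nneg// ler_linsum.
rewrite (le_trans H1)// /compression_const -/L.
have Bp := powR_ge0 B p.
have step : powsum p U a j <= 2 * (c `^ p * (2 * L) + 1) * B `^ p by lra.
rewrite (@le_trans _ _ (L * (2 * (c `^ p * (2 * L) + 1) * B `^ p)))//.
  by rewrite ler_wpM2l.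
rewrite mulrA [2 * L]mulrC -[L * 2 * _]mulrA ler_wpM2l// !mulr_ge0// addr_ge0//.
by rewrite !mulr_ge0.
Qed.

(** * Concentration for sequences indexed by the integers *)

(** The two directions of summation share this property, with [k i n = U i n] and
    [J n] the indices up to [n], or with [k i n = U n i] and [J n] the indices
    from [n] on.  Since [b] may depend on the window [M], finite constructions
    suffice; [K] does not depend on it. *)
Definition compressible {R : realType} (p K : R) (k : int -> int -> R)
    (J : int -> set int) (v : int -> R) : Prop :=
  forall (M : nat) (a : int -> R), (forall i, 0 <= a i) ->
    (forall i, (M < `|i|)%N -> a i = 0) ->
  exists b : int -> R, [/\ forall i, 0 <= b i,
    (\esum_(i in [set: int]) (b i `^ p * v i)%:E <=
      2%:E * \esum_(i in [set: int]) (a i `^ p * v i)%:E)%E &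
    forall n, (`|n| <= M)%N ->
      (\esum_(i in J n) ((k i n * a i) `^ p)%:E <=
       K%:E * (\esum_(i in J n) (k i n * b i)%:E) `^ p)%E].

(** Here [s] enumerates the part of [J] outside which [f] vanishes. *)
Lemma esum_window {R : realType} (s : nat -> int) (k : nat) (J : set int)
    (f : int -> R) :
  injective s -> (forall i, 0 <= f i) ->
  (forall i, (i < k)%N -> J (s i)) ->
  (forall i, J i -> (forall j, (j < k)%N -> i <> s j) -> f i = 0) ->
  (\esum_(i in J) (f i)%:E = (\sum_(0 <= j < k) f (s j))%:E)%E.
Proof.
move=> sI f0 sJ f0'.
transitivity (\esum_(i in s @` `I_k) (f i)%:E)%E.
  rewrite esum_mkcond [RHS]esum_mkcond; apply: eq_esum => i _.
  case: ifPn => [/set_mem Ji|/negP Ji];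
      case: ifPn => [/set_mem sI'|/negP sI']//.
    by rewrite f0'// => j jk ij; apply: sI'; rewrite inE; exists j.
  by case: sI' Ji => j jk <- []; rewrite inE; exact: sJ.
rewrite esum_image; last by move=> i j _ _; exact: sI.
rewrite esum_fset//; last by move=> i _; rewrite lee_fin.
by rewrite -fsbig_ord/= big_mkord sumEFin.
Qed.

Lemma lower_compressible {R : realType} (p c : R) (U : int -> int -> R)
    (v : int -> R) :
  0 < p -> p <= 1 -> regular_kernel c U -> (forall n, 0 <= v n) ->
  compressible p (compression_const p c) U (fun n => [set i | i <= n]) v.
Proof.
move=> p0 p1 [U0 Ul Ur c0 Uq] v0 M a a0 aM.
pose s (j : nat) : int := j%:Z - M%:Z.
have sI : injective s by move=> i j; rewrite /s; lia.
have [b [b0 bv bK]] := @regular_concentration R p c (fun i n => U (s i) (s n))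
  (a \o s) (v \o s) M.*2.+1 p0 p1 c0 (fun _ _ => U0 _ _)
  (fun i j n ij => Ul (s i) (s j) (s n) ltac:(rewrite /s; lia))
  (fun i j n ij => Ur (s i) (s j) (s n) ltac:(rewrite /s; lia))
  (fun i j n ij jn => Uq (s i) (s j) (s n) ltac:(rewrite /s; lia) ltac:(rewrite /s; lia))
  (fun _ => a0 _) (fun _ => v0 _).
pose b' (i : int) : R := if (`|i| <= M)%N then b (absz (i + M%:Z)) else 0.
have b's j : (j < M.*2.+1)%N -> b' (s j) = b j.
  rewrite /b' /s => jM; case: ifPn; last by lia.
  by move=> _; congr b; lia.
have b'0 i : 0 <= b' i by rewrite /b'; case: ifPn.
have b'M i : (M < `|i|)%N -> b' i = 0 by rewrite /b'; case: ifPn => //; lia.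
have total (f : int -> R) : (forall i, 0 <= f i) -> (forall i, (M < `|i|)%N -> f i = 0) ->
    (\esum_(i in [set: int]) (f i)%:E = (\sum_(0 <= j < M.*2.+1) f (s j))%:E)%E.
  move=> f0 fM; apply: esum_window => // i _ iM; apply: fM.
  rewrite ltnNge; apply/negP => iM'; apply: (iM (absz (i + M%:Z))); rewrite ?/s; lia.
have initial (f : int -> R) (n : int) : (`|n| <= M)%N -> (forall i, 0 <= f i) ->
    (forall i, (M < `|i|)%N -> f i = 0) ->
    (\esum_(i in [set i : int | (i <= n)%R]) (f i)%:E =
      (\sum_(0 <= j < (absz (n + M%:Z)).+1) f (s j))%:E)%E.
  move=> nM f0 fM; apply: esum_window => //.
    by move=> i; rewrite /s /=; lia.
  move=> i /= ni iM; apply: fM.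
  rewrite ltnNge; apply/negP => iM'; apply: (iM (absz (i + M%:Z))); rewrite ?/s; lia.
have pow0 x : (x = 0 -> x `^ p = 0 :> R) by move=> ->; rewrite powR0 ?gt_eqF.
exists b'; split => //.
  rewrite !total; do ?by move=> i; rewrite mulr_ge0// powR_ge0.
  - rewrite -EFinM lee_fin (le_trans _ bv)// big_nat [leRHS]big_nat.
    by apply: ler_sum => j jM; rewrite b's.
  - by move=> i iM; rewrite aM// pow0// mul0r.
  - by move=> i iM; rewrite b'M// pow0// mul0r.
move=> n nM; rewrite !initial//.
- have -> : n = s (absz (n + M%:Z)) by rewrite /s; lia.
  have := bK (absz (n + M%:Z)).+1 ltac:(lia).
  rewrite /powsum /linsum -EFinM lee_fin/=.
  have -> : absz (s (absz (n + M%:Z)) + M%:Z) = absz (n + M%:Z) by rewrite /s; lia.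
  move=> /le_trans; apply; rewrite le_eqVlt; apply/orP; left; apply/eqP.
  congr (_ * _ `^ _); rewrite big_nat [RHS]big_nat.
  by apply: eq_bigr => j jn; rewrite b's//; lia.
- by move=> i; rewrite mulr_ge0.
- by move=> i iM; rewrite b'M// mulr0.
- by move=> i; rewrite powR_ge0.
- by move=> i iM; rewrite aM// mulr0 pow0.
Qed.

Lemma esum_opp {R : realType} (P Q : set int) (f : int -> \bar R) :
  (forall i, P i <-> Q (- i)) ->
  (\esum_(i in Q) f i = \esum_(i in P) f (- i)%R)%E.
Proof.
move=> PQ; apply: reindex_esum; split.
- by move=> i /= /PQ.
- by move=> i j _ _; exact: oppr_inj.
- by move=> i Qi; exists (- i); rewrite ?opprK//; apply/PQ; rewrite opprK.
Qed.

Lemma upper_compressible {R : realType} (p c : R) (U : int -> int -> R)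
    (v : int -> R) :
  0 < p -> p <= 1 -> regular_kernel c U -> (forall n, 0 <= v n) ->
  compressible p (compression_const p c) (fun i n => U n i)
    (fun n => [set i | n <= i]) v.
Proof.
move=> p0 p1 [U0 Ul Ur c0 Uq] v0 M a a0 aM.
have rU' : regular_kernel c (fun i n => U (- n) (- i)).
  split => //.
  - by move=> i j n ij; apply: Ur; rewrite lerN2.
  - by move=> i m n mn; apply: Ul; rewrite lerN2.
  - by move=> i j n ij jn; rewrite addrC Uq// lerN2.
have [|i iM|b [b0 bv bK]] := lower_compressible p0 p1 rU' (fun n => v0 (- n))
  (M := M) (a := fun i => a (- i)).
- by move=> i; exact: a0.
- by apply: aM; lia.
exists (fun i => b (- i)); split => //.
  rewrite (@esum_opp _ setT)//.
  under eq_esum do rewrite opprK.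
  by rewrite [in leRHS](@esum_opp _ setT).
move=> n nM; have := bK (- n) ltac:(lia).
have NS i : [set i | i <= - n] i <-> [set i | n <= i] (- i) by rewrite /= lerNr.
rewrite !(esum_opp _ NS).
by under [in X in _ -> (_ <= _ * X `^ _)%E]eq_esum do rewrite opprK; rewrite opprK.
Qed.

(** * Extended real numbers and truncation *)

Section ereal_tools.
Context {R : realType}.
Local Open Scope ereal_scope.

Lemma lee_poweR (r : R) (x y : \bar R) :
  (0 < r)%R -> 0 <= x -> x <= y -> x `^ r <= y `^ r.
Proof.
move=> r0 x0 xy; apply: gt0_ler_poweR => //; first exact: ltW.
  by rewrite in_itv/= x0 leey.
by rewrite in_itv/= leey (le_trans x0).
Qed.

Lemma poweR_invK (r : R) (x : \bar R) : r != 0%R -> 0 <= x ->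
  (x `^ r^-1) `^ r = x.
Proof. by move=> r0 x0; rewrite -poweRrM mulVf// poweRe1. Qed.

Lemma poweRK_inv (r : R) (x : \bar R) : r != 0%R -> 0 <= x ->
  (x `^ r) `^ r^-1 = x.
Proof. by move=> r0 x0; rewrite -poweRrM mulfV// poweRe1. Qed.

Lemma poweR_le_inv (r : R) (x y : \bar R) : (0 < r)%R -> 0 <= x -> 0 <= y ->
  x <= y `^ r^-1 <-> x `^ r <= y.
Proof.
move=> r0 x0 y0; have rn0 : r != 0%R by rewrite gt_eqF.
split=> [/(lee_poweR r0 x0)|]; first by rewrite poweR_invK.
have ri0 : (0 < r^-1)%R by rewrite invr_gt0.
by move=> /(lee_poweR ri0 (poweR_ge0 _ _)); rewrite poweRK_inv.
Qed.

Lemma esum_le_fin (T : choiceType) (S : set T) (f : T -> \bar R) (x : \bar R) :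
  (forall X, finite_set X -> X `<=` S -> \sum_(i \in X) f i <= x) ->
  \esum_(i in S) f i <= x.
Proof. by move=> H; apply: ge_ereal_sup => _ [X [fX XS] <-]; exact: H. Qed.

Lemma fsum_le_esum (T : choiceType) (S X : set T) (f : T -> \bar R) :
  finite_set X -> X `<=` S -> \sum_(i \in X) f i <= \esum_(i in S) f i.
Proof. by move=> fX XS; apply: esum_ge; exists X. Qed.

Lemma ge0_esumZl (T : choiceType) (S : set T) (f : T -> \bar R) (c : R) :
  (0 <= c)%R -> (forall i, 0 <= f i) ->
  \esum_(i in S) (c%:E * f i) = c%:E * \esum_(i in S) f i.
Proof.
have le (d : R) (g : T -> \bar R) : (0 <= d)%R -> (forall i, 0 <= g i) ->
    \esum_(i in S) (d%:E * g i) <= d%:E * \esum_(i in S) g i.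
  move=> d0 g0; apply: esum_le_fin => X fX XS.
  by rewrite -ge0_mule_fsumr// lee_wpmul2l ?lee_fin// fsum_le_esum.
rewrite le_eqVlt => /predU1P[<- f0|c0 f0].
  by rewrite mul0e esum1// => i _; rewrite mul0e.
apply/eqP; rewrite eq_le (le _ _ (ltW c0) f0)/= -lee_pdivlMl//.
apply: le_trans (le _ _ _ _); last 2 first.
- by rewrite invr_ge0 ltW.
- by move=> i; rewrite mule_ge0// lee_fin ltW.
apply: le_esum => i _.
by rewrite muleA -EFinM mulVf ?gt_eqF// mul1e.
Qed.

Lemma poweR_esum_subadd (T : choiceType) (S : set T) (f : T -> R) (p : R) :
  (0 < p)%R -> (p <= 1)%R -> (forall i, (0 <= f i)%R) ->
  (\esum_(i in S) (f i)%:E) `^ p <= \esum_(i in S) (f i `^ p)%:E.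
Proof.
move=> p0 p1 f0.
have s0 : 0 <= \esum_(i in S) (f i `^ p)%:E.
  by apply: esum_ge0 => i _; rewrite lee_fin powR_ge0.
apply/poweR_le_inv => //; first by apply: esum_ge0 => i _; rewrite lee_fin.
apply: esum_le_fin => X fX XS; apply/poweR_le_inv => //.
  by apply: fsume_ge0 => // i _; rewrite lee_fin.
apply: le_trans (fsum_le_esum _ fX XS).
by rewrite !fsbig_finite//= !sumEFin poweR_EFin lee_fin powR_sum_subadd.
Qed.

Definition truncation (F : int -> \bar R) (N : nat) (i : int) : R :=
  if (`|i| <= N)%N then fine (mine (F i) N%:R%:E) else 0%R.

Section truncation.
Variable F : int -> \bar R.
Hypothesis F0 : forall i, 0 <= F i.

Lemma truncationE N i : (`|i| <= N)%N -> (truncation F N i)%:E = mine (F i) N%:R%:E.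
Proof.
move=> iN; rewrite /truncation iN fineK//.
have := F0 i; case: (F i) => [r _|_|] //.
by rewrite -EFin_min.
Qed.

Lemma truncation_le N i : (truncation F N i)%:E <= F i.
Proof.
have [iN|iN] := leqP `|i| N; first by rewrite truncationE// ge_min lexx.
by rewrite /truncation leqNgt iN.
Qed.

Lemma truncation_ge0 N i : (0 <= truncation F N i)%R.
Proof.
have [iN|iN] := leqP `|i| N; last by rewrite /truncation leqNgt iN.
by rewrite -lee_fin truncationE// le_min F0 lee_fin/=.
Qed.

Lemma truncation0 N i : (N < `|i|)%N -> truncation F N i = 0%R.
Proof. by move=> iN; rewrite /truncation leqNgt iN. Qed.

Lemma truncation_cvg i : (truncation F N i)%:E @[N --> \oo] --> F i.
Proof.
case Fi : (F i) => [r| |]; last by have := F0 i; rewrite Fi.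
- apply: cvg_near_cst; near=> N.
  rewrite truncationE; last by near: N; exact: nbhs_infty_ge.
  by rewrite Fi -EFin_min min_l//; near: N; exact: nbhs_infty_ger.
- apply/cvgeryP/cvgryPge => A; near=> N.
  rewrite -lee_fin truncationE; last by near: N; exact: nbhs_infty_ge.
  by rewrite Fi min_r ?leey// lee_fin; near: N; exact: nbhs_infty_ger.
Unshelve. all: by end_near. Qed.

(** Only a lower bound is claimed, so a finite subsum above [y] suffices; it
    converges because its terms do, infinite values of [F] included. *)
Lemma truncation_lower_semicont (S : set int) (g : int -> R) (y : \bar R) :
  (forall i, (0 <= g i)%R) ->
  y < \esum_(i in S) ((g i)%:E * F i) ->
  \forall N \near \oo, y < \esum_(i in S) (g i * truncation F N i)%:E.
Proof.
move=> g0 /ereal_sup_gt[_ [X [fX XS] <-] yX].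
have cv : \sum_(i \in X) (g i * truncation F N i)%:E @[N --> \oo] -->
    \sum_(i \in X) ((g i)%:E * F i).
  under eq_fun do rewrite fsbig_finite//.
  rewrite fsbig_finite//; apply: cvg_nnesum => i _.
    by apply: nearW => N; rewrite lee_fin mulr_ge0 ?truncation_ge0.
  by under eq_fun do rewrite EFinM; apply: cvgeZl => //; exact: truncation_cvg.
have : \forall N \near \oo, y < \sum_(i \in X) (g i * truncation F N i)%:E.
  exact: cv _ (open_nbhs_nbhs (conj (@open_ereal_gt_ereal R y) yX)).
apply: filterS => N /lt_le_trans; apply.
exact: fsum_le_esum.
Qed.
End truncation.
End ereal_tools.

(** * From l^1 to l^p inner sums *)

(** Common form of [discrete_lower] and [discrete_upper]. *)
Definition sequence_inequality {R : realType} (p q : R) (k : int -> int -> R)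
    (J : int -> set int) (v w : int -> R) (C : R) : Prop :=
  forall a : int -> R, (forall n, 0 <= a n) ->
    ((\esum_(n in [set: int])
       ((\esum_(i in J n) (k i n * a i)%:E) `^ q * (w n)%:E)) `^ q^-1
    <= C%:E * (\esum_(n in [set: int]) (a n `^ p * v n)%:E) `^ p^-1)%E.

Lemma near_seq (T : eqType) (s : seq T) (P : T -> nat -> Prop) :
  (forall x, x \in s -> \forall N \near \oo, P x N) ->
  \forall N \near \oo, forall x, x \in s -> P x N.
Proof.
elim: s => [|x s IH] H; first exact: nearW.
have Hx := H _ (mem_head _ _).
have Hs : \forall N \near \oo, forall y, y \in s -> P y N.
  by apply: IH => y ys; apply: H; rewrite inE ys orbT.
near=> N => y; rewrite inE => /predU1P[->|].
  by near: N.
by move: y; near: N.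
Unshelve. all: by end_near. Qed.

Section discrete.
Context {R : realType}.
Variables (p q K C : R) (k : int -> int -> R) (J : int -> set int) (v w : int -> R).
Hypotheses (p0 : 0 < p) (q0 : 0 < q) (K0 : 0 <= K) (C0 : 0 <= C).
Hypotheses (k0 : forall i n, 0 <= k i n) (v0 : forall n, 0 <= v n)
  (w0 : forall n, 0 <= w n).
Hypothesis kJ : compressible p K k J v.
Hypothesis ineq : sequence_inequality p q k J v w C.
Local Open Scope ereal_scope.

Let pn0 : p != 0%R. Proof. by rewrite gt_eqF. Qed.
Let qp0 : (0 < q / p)%R. Proof. by rewrite divr_gt0. Qed.

(** The inequality for sequences is applied to the concentrated version of
    [x `^ p^-1]. *)
Lemma power_inequality_window (M : nat) (x : int -> R) (X : set int) :
  (forall i, (0 <= x i)%R) -> (forall i, (M < `|i|)%N -> x i = 0%R) ->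
  finite_set X -> (forall n, X n -> (`|n| <= M)%N) ->
  \sum_(n \in X) ((\esum_(i in J n) (k i n `^ p * x i)%:E) `^ (q / p) * (w n)%:E)
  <= ((2 * K * C `^ p)%:E * \esum_(i in [set: int]) (x i * v i)%:E) `^ (q / p).
Proof.
move=> x0 xM fX XM.
have aM i : (M < `|i|)%N -> (x i `^ p^-1 = 0)%R.
  by move=> /xM ->; rewrite powR0// invr_neq0.
have [b [b0 bv bK]] := kJ (fun i => powR_ge0 (x i) p^-1) aM.
pose B n := \esum_(i in J n) (k i n * b i)%:E.
have B0 n : 0 <= B n by apply: esum_ge0 => i _; rewrite lee_fin mulr_ge0.
pose Y := \esum_(i in [set: int]) (b i `^ p * v i)%:E.
have Y0 : 0 <= Y by apply: esum_ge0 => i _; rewrite lee_fin mulr_ge0 ?powR_ge0.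
pose Z := \esum_(i in [set: int]) (x i * v i)%:E.
have Z0 : 0 <= Z by apply: esum_ge0 => i _; rewrite lee_fin mulr_ge0.
have {bv} YZ : Y <= 2%:E * Z.
  rewrite (le_trans bv)// le_eqVlt; apply/orP; left; apply/eqP.
  by congr (_ * _); apply: eq_esum => i _; rewrite powR_invK.
have KB n : X n -> (\esum_(i in J n) (k i n `^ p * x i)%:E) `^ (q / p)
    <= (K `^ (q / p))%:E * B n `^ q.
  move=> /XM/bK bKn.
  have -> : (K `^ (q / p))%:E * B n `^ q = (K%:E * B n `^ p) `^ (q / p).
    rewrite poweRM ?lee_fin ?poweR_ge0// -poweRrM.
    by rewrite poweR_EFin [(p * _)%R]mulrC divfK.
  apply: lee_poweR => //.
    by apply: esum_ge0 => i _; rewrite lee_fin mulr_ge0 ?powR_ge0.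
  apply: le_trans bKn; apply: le_esum => i _.
  by rewrite lee_fin powRM ?powR_ge0// powR_invK.
apply: (@le_trans _ _ ((K `^ (q / p))%:E *
    \esum_(n in [set: int]) (B n `^ q * (w n)%:E))).
  have Bw0 n : 0 <= B n `^ q * (w n)%:E by rewrite mule_ge0 ?poweR_ge0 ?lee_fin.
  apply: (@le_trans _ _ ((K `^ (q / p))%:E * \sum_(n \in X) (B n `^ q * (w n)%:E))).
    rewrite ge0_mule_fsumr//; apply: lee_fsum => // n Xn.
    by rewrite muleA lee_wpmul2r ?lee_fin// KB.
  by rewrite lee_wpmul2l ?lee_fin ?powR_ge0// fsum_le_esum.
apply: (@le_trans _ _ ((K `^ (q / p))%:E * (C%:E * Y `^ p^-1) `^ q)).
  rewrite lee_wpmul2l ?lee_fin ?powR_ge0//.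
  have := ineq b0; rewrite -/Y.
  have qi0 : (0 < q^-1)%R by rewrite invr_gt0.
  move/(lee_poweR q0 (poweR_ge0 _ _)); rewrite poweR_invK ?gt_eqF//.
  by apply: esum_ge0 => n _; rewrite mule_ge0 ?poweR_ge0 ?lee_fin.
have -> : (K `^ (q / p))%:E * (C%:E * Y `^ p^-1) `^ q =
    ((K * C `^ p)%:E * Y) `^ (q / p).
  rewrite !poweRM ?lee_fin ?poweR_ge0 ?mulr_ge0 ?powR_ge0//.
  rewrite -poweRrM [(p^-1 * q)%R]mulrC !poweR_EFin powRM ?powR_ge0//.
  by rewrite -powRrM [(p * _)%R]mulrC divfK// EFinM muleA.
apply: lee_poweR => //; first by rewrite mule_ge0 ?lee_fin ?mulr_ge0 ?powR_ge0.
have -> : (2 * K * C `^ p)%:E * Z = (K * C `^ p)%:E * (2%:E * Z).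
  by rewrite muleA -EFinM; congr (_%:E * _); ring.
by rewrite lee_wpmul2l// lee_fin mulr_ge0 ?powR_ge0.
Qed.

(** The passage to the limit gives up a factor 2: if the right-hand side is
    finite, then so is the inner sum [A n] whenever [0 < w n], and truncation far
    enough captures more than half of it for all the finitely many [n] of a
    partial outer sum. *)
Lemma power_inequality (F : int -> \bar R) : (forall i, 0 <= F i) ->
  \esum_(n in [set: int])
    ((\esum_(i in J n) ((k i n `^ p)%:E * F i)) `^ (q / p) * (w n)%:E)
  <= ((4 * K * C `^ p)%:E * \esum_(i in [set: int]) ((v i)%:E * F i)) `^ (q / p).
Proof.
move=> F0.
pose A n := \esum_(i in J n) ((k i n `^ p)%:E * F i).
have A0 n : 0 <= A n.
  by apply: esum_ge0 => i _; rewrite mule_ge0 ?lee_fin ?powR_ge0.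
pose AN N n := \esum_(i in J n) (k i n `^ p * truncation F N i)%:E.
have AN0 N n : 0 <= AN N n.
  by apply: esum_ge0 => i _; rewrite lee_fin mulr_ge0 ?powR_ge0 ?truncation_ge0.
pose W := \esum_(i in [set: int]) ((v i)%:E * F i).
have W0 : 0 <= W by apply: esum_ge0 => i _; rewrite mule_ge0 ?lee_fin.
have c0 : (0 <= 2 * K * C `^ p)%R by rewrite !mulr_ge0 ?powR_ge0.
pose m := (2 * K * C `^ p)%:E * W.
have m0 : 0 <= m by rewrite mule_ge0 ?lee_fin.
have win N X : finite_set X -> (forall n, X n -> (`|n| <= N)%N) ->
    \sum_(n \in X) (AN N n `^ (q / p) * (w n)%:E) <= m `^ (q / p).
  move=> fX XN; apply: le_trans (power_inequality_window _ _ fX XN) _.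
  - by move=> i; exact: truncation_ge0.
  - by move=> i; exact: truncation0.
  apply: lee_poweR => //.
    rewrite mule_ge0 ?lee_fin// esum_ge0// => i _.
    by rewrite lee_fin mulr_ge0 ?truncation_ge0.
  rewrite lee_wpmul2l ?lee_fin//; apply: le_esum => i _.
  by rewrite EFinM muleC lee_wpmul2l ?lee_fin// truncation_le.
have -> : (4 * K * C `^ p)%:E * W = 2%:E * m.
  by rewrite /m muleA -EFinM; congr (_%:E * _); ring.
have [moo|mfin] := eqVneq m +oo.
  by rewrite moo mulry gtr0_sg// mul1e poweRyr ?gt_eqF// leey.
have lsc n y : y < A n -> \forall N \near \oo, y < AN N n.
  by apply: truncation_lower_semicont => // i; exact: powR_ge0.
rewrite poweRM ?lee_fin//.
apply: esum_le_fin => X fX _.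
have near_half n : \forall N \near \oo, A n `^ (q / p) * (w n)%:E <=
    2%:E `^ (q / p) * (AN N n `^ (q / p) * (w n)%:E).
  have nn N : 0 <= 2%:E `^ (q / p) * (AN N n `^ (q / p) * (w n)%:E).
    by rewrite !mule_ge0 ?poweR_ge0 ?lee_fin.
  have [wn|wn] := eqVneq (w n) 0%R.
    by apply: nearW => N; rewrite wn !mule0.
  have wgt : (0 < w n)%R by rewrite lt_neqAle eq_sym wn w0.
  have [An|An] := eqVneq (A n) 0.
    by apply: nearW => N; rewrite An poweR0r ?gt_eqF// mul0e.
  (* Otherwise truncations would reach [y], whose power times [w n] exceeds the
     bound by [w n]. *)
  have Afin : A n < +oo.
    rewrite ltey; apply/eqP => Aoo.
    have mrfin : m `^ (q / p) \is a fin_num.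
      by rewrite fin_num_poweR// ge0_fin_numE// ltey.
    pose y := ((fine (m `^ (q / p)) / w n + 1) `^ (q / p)^-1)%R.
    have yA : y%:E < A n by rewrite Aoo ltey.
    have [N [yN nN]] : exists N, y%:E < AN N n /\ (`|n| <= N)%N.
      have near2 : \forall N \near \oo, y%:E < AN N n /\ (`|n| <= N)%N.
        by apply: filterI; [exact: lsc|exact: nbhs_infty_ge].
      by have [N] := @filter_ex _ _ _ _ near2; exists N.
    have := win N [set n] (finite_set1 n) (fun i => ltac:(by move=> /= ->)).
    rewrite fsbig_set1 leNgt => /negP; apply.
    have d0 : (0 <= fine (m `^ (q / p)) / w n)%R.
      by rewrite divr_ge0// fine_ge0// poweR_ge0.
    apply: (@lt_le_trans _ _ ((y `^ (q / p))%:E * (w n)%:E)).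
      rewrite /y powR_invK ?gt_eqF ?addr_ge0// -EFinM mulrDl divfK// mul1r EFinD.
      by rewrite fineK// lteDl// lte_fin.
    rewrite lee_wpmul2r ?lee_fin// -poweR_EFin lee_poweR// ?lee_fin ?powR_ge0//.
    exact: ltW.
  have Ahalf : 2^-1%:E * A n < A n.
    rewrite lte_pdivrMl// -[ltLHS]mul1e lte_pmul2r ?lte_fin ?ltr1n//.
    - by rewrite ge0_fin_numE.
    - by rewrite lt_neqAle eq_sym An A0.
  have := lsc _ _ Ahalf; apply: filterS => N AN'.
  rewrite muleA lee_wpmul2r ?lee_fin// -poweRM ?lee_fin//.
  by rewrite lee_poweR// -lee_pdivrMl// ltW.
have [N [NX NH]] : exists N, (forall n, X n -> (`|n| <= N)%N) /\
    (forall n, X n -> A n `^ (q / p) * (w n)%:E <=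
      2%:E `^ (q / p) * (AN N n `^ (q / p) * (w n)%:E)).
  have /finite_seqP[s sX] := fX.
  have near2 : \forall N \near \oo, forall n, n \in s ->
     A n `^ (q / p) * (w n)%:E <=
      2%:E `^ (q / p) * (AN N n `^ (q / p) * (w n)%:E) /\ (`|n| <= N)%N.
    apply: near_seq => n _.
    by apply: filterI; [exact: near_half|exact: nbhs_infty_ge].
  have [N HN] := @filter_ex _ _ _ _ near2; exists N.
  by split=> n; rewrite sX => /HN[].
apply: (@le_trans _ _ (2%:E `^ (q / p) * \sum_(n \in X) (AN N n `^ (q / p) * (w n)%:E))).
  rewrite ge0_mule_fsumr//; last by move=> n; rewrite mule_ge0 ?poweR_ge0 ?lee_fin.
  exact: lee_fsum.
by rewrite lee_wpmul2l ?poweR_ge0// win.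
Qed.
End discrete.

(** * Integration over the unit cells *)

Section cells.
Context {R : realType}.
Notation mu := (@lebesgue_measure R).

Lemma cellE (n : int) : cell R n = [set t | Num.ceil t = n].
Proof.
apply/seteqP; split=> t /=.
  by move=> tn; apply/esym/eqP; rewrite -in_cell inE.
by move=> /esym/eqP; rewrite -in_cell inE.
Qed.

Lemma measurable_cell (n : int) : measurable (cell R n).
Proof. exact: measurable_itv. Qed.

(** A bijection from the natural numbers, used to write the line as a countable
    union of cells indexed by [nat]. *)
Definition int_of_code (n : nat) : int := if odd n then Negz n./2 else Posz n./2.

Lemma int_of_code_bij : set_bij [set: nat] [set: int] int_of_code.
Proof.
split=> //.
  move=> i j _ _; rewrite /int_of_code.
  have := odd_double_half i; have := odd_double_half j.
  by case: (odd i) (odd j) => [] [] /= ? ? //=; case; lia.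
move=> [n|n] _; [exists n.*2 => //|exists n.*2.+1 => //]; rewrite /int_of_code /=.
  by rewrite odd_double doubleK.
by rewrite odd_double /= uphalf_double.
Qed.

Lemma bigcup_cell (A : set int) :
  [set t : R | A (Num.ceil t)] =
  \bigcup_(n in [set n | A (int_of_code n)]) cell R (int_of_code n).
Proof.
have [_ _ sur] := int_of_code_bij.
apply/seteqP; split=> t /=; last by move=> [n /= An]; rewrite cellE /= => ->.
have [n _ nt] := sur (Num.ceil t) I.
by move=> At; exists n; rewrite /= ?cellE/= nt.
Qed.

Lemma measurable_ceil_comp d (T : measurableType d) (h : int -> T) :
  measurable_fun [set: R] (fun t : R => h (Num.ceil t)).
Proof.
move=> _ Y mY; rewrite setTI.
have -> : (fun t : R => h (Num.ceil t)) @^-1` Y =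
    [set t : R | (h @^-1` Y) (Num.ceil t)] by [].
by rewrite bigcup_cell; apply: bigcup_measurable => n _; exact: measurable_cell.
Qed.

Local Open Scope ereal_scope.

Lemma integral_cells (f : R -> \bar R) :
  measurable_fun [set: R] f -> (forall t, 0 <= f t) ->
  \int[mu]_t f t = \esum_(n in [set: int]) \int[mu]_(t in cell R n) f t.
Proof.
move=> mf f0.
have E : [set: R] = \bigcup_n cell R (int_of_code n) by rewrite -(bigcup_cell setT).
rewrite {1}E ge0_integral_bigcup//.
- rewrite (reindex_esum _ _ _ _ int_of_code_bij) nneseries_esumT// => n.
  exact: integral_ge0.
- by move=> n; exact: measurable_cell.
- by rewrite -E.
- apply/trivIsetP => i j _ _ /eqP ij; apply/seteqP; split=> t //=.
  rewrite !cellE /= => -[ti tj]; apply: ij.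
  have [_ inj _] := int_of_code_bij.
  by apply: inj; rewrite ?inE// -ti -tj.
Qed.

Lemma integral_ceil_mul (h : int -> \bar R) (f : R -> \bar R) :
  measurable_fun [set: R] f -> (forall i, 0 <= h i) -> (forall t, 0 <= f t) ->
  \int[mu]_t (h (Num.ceil t) * f t) =
  \esum_(n in [set: int]) (h n * \int[mu]_(t in cell R n) f t).
Proof.
move=> mf h0 f0; rewrite integral_cells.
- apply: eq_esum => n _.
  rewrite -ge0_integralZl//; last 2 first.
  + exact: measurable_cell.
  + exact: measurable_funTS.
  by apply: eq_integral => t /set_mem; rewrite cellE /= => ->.
- by apply: emeasurable_funM => //; exact: measurable_ceil_comp.
- by move=> t; rewrite mule_ge0.
Qed.

(** The integral of a nonnegative function is a supremum over the simple functions
    below it, so it is monotone on all nonnegative functions.  In this form it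
    applies to the inner integrals as functions of the outer variable. *)
Lemma le_integral_ge0 (f g : R -> \bar R) :
  (forall t, 0 <= f t) -> (forall t, f t <= g t) ->
  \int[mu]_t f t <= \int[mu]_t g t.
Proof.
move=> f0 fg; rewrite !ge0_integralTE//; last by move=> t; rewrite (le_trans (f0 t)).
apply: le_ereal_sup => _ [h /= hf <-]; exists h => // t.
exact: le_trans (hf t) (fg t).
Qed.

Lemma integral_cell1 (n : int) : \int[mu]_(t in cell R n) 1 = 1.
Proof.
rewrite integral_cst ?mul1e; last exact: measurable_cell.
by rewrite /= lebesgue_measure_itv/= lte_fin ltrBlDr ltrDl ltr01 -EFinB opprB addrC subrK.
Qed.

(** Splitting each cell at its midpoint puts every point of the left half before
    every point of the right half, in the same cell too. *)
Definition left_half : set R := [set t | (t <= (Num.ceil t)%:~R - 2^-1)%R].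
Definition right_half : set R := [set t | ((Num.ceil t)%:~R - 2^-1 < t)%R].

Lemma measurable_left_half : measurable left_half.
Proof.
have -> : left_half = [set t : R | true = (t <= (Num.ceil t)%:~R - 2^-1)%R].
  by apply/seteqP; split=> t /= /esym.
rewrite -[X in measurable X]setTI; apply: measurable_fun_ler => //.
apply: measurable_funB => //; exact: (measurable_ceil_comp (fun n => n%:~R : R)).
Qed.

Lemma right_halfC : right_half = ~` left_half.
Proof. by apply/seteqP; split=> t; rewrite /right_half /left_half /= ltNge => /negP. Qed.

Lemma measurable_right_half : measurable right_half.
Proof. by rewrite right_halfC; exact: measurableC measurable_left_half. Qed.

Lemma integral_left_half (n : int) :
  \int[mu]_(t in cell R n) (\1_left_half t)%:E = (2^-1)%:E.
Proof.
rewrite integral_indic; [|exact: measurable_cell|exact: measurable_left_half].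
have -> : left_half `&` cell R n = [set` `](n%:~R - 1)%R, (n%:~R - 2^-1)%R]%R].
  rewrite cellE; apply/seteqP; split=> t /=; rewrite in_itv/=.
    move=> [tl tn]; move: tl; rewrite /left_half /= tn => ->; rewrite andbT.
    by rewrite -tn; have := Num.Theory.ceil_itv t; lra.
  move=> /andP[t1 t2].
  suff tn : Num.ceil t = n by rewrite /left_half /= tn.
  by apply/eqP; rewrite Num.Theory.ceil_eq intrB mulr1z; lra.
rewrite /= lebesgue_measure_itv/= lte_fin ifT; last by lra.
by rewrite -EFinB; congr EFin; lra.
Qed.

Lemma integral_right_half (n : int) :
  \int[mu]_(t in cell R n) (\1_right_half t)%:E = (2^-1)%:E.
Proof.
have E : \int[mu]_(t in cell R n) (\1_left_half t)%:E +
    \int[mu]_(t in cell R n) (\1_right_half t)%:E = 1.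
  rewrite -ge0_integralD//.
  - rewrite -[RHS](integral_cell1 n); apply: eq_integral => t _.
    by rewrite right_halfC -EFinD !indicE in_setC; case: (t \in _); rewrite ?addr0 ?add0r.
  - exact: measurable_cell.
  - apply/measurable_EFinP; apply: measurable_indic; exact: measurable_left_half.
  - apply/measurable_EFinP; apply: measurable_indic; exact: measurable_right_half.
rewrite integral_left_half in E.
have : \int[mu]_(t in cell R n) (\1_right_half t)%:E = 1 - (2^-1)%:E.
  by rewrite -E addeAC subee// add0e.
by move=> ->; rewrite -EFinB; congr EFin; lra.
Qed.
End cells.

(** * Comparing the inequalities for sequences and for functions *)

(** Common form of [continuous_lower] and [continuous_upper], with [E t] the
    half-line of integration at [t]. *)
Definition function_inequality {R : realType} (p q : R) (k : int -> int -> R)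
    (E : R -> set R) (v w : int -> R) (C : R) : Prop :=
  forall f : R -> R, measurable_fun [set: R] f -> (forall t, 0 <= f t) ->
    ((\int[lebesgue_measure]_(t in [set: R])
       ((\int[lebesgue_measure]_(s in E t)
           (k (Num.ceil s) (Num.ceil t) `^ p * f s)%:E) `^ (q / p)
        * (w (Num.ceil t))%:E)) `^ (p / q)
    <= C%:E *
       \int[lebesgue_measure]_(t in [set: R]) (f t * v (Num.ceil t))%:E)%E.

Section transfer.
Context {R : realType}.
Notation mu := (@lebesgue_measure R).
Variables (p q : R) (k : int -> int -> R) (J : int -> set int) (E : R -> set R)
  (v w : int -> R).
Hypotheses (p0 : 0 < p) (q0 : 0 < q).
Hypotheses (k0 : forall i n, 0 <= k i n) (v0 : forall n, 0 <= v n)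
  (w0 : forall n, 0 <= w n).
Local Open Scope ereal_scope.

Let qp0 : (0 < q / p)%R. Proof. by rewrite divr_gt0. Qed.
Let pq0 : (0 < p / q)%R. Proof. by rewrite divr_gt0. Qed.
Let pqE : (p / q = (q / p)^-1)%R. Proof. by rewrite invf_div. Qed.

Let inner_ge0 (f : R -> R) t : (forall t, (0 <= f t)%R) ->
  0 <= \int[mu]_(s in E t) (k (Num.ceil s) (Num.ceil t) `^ p * f s)%:E.
Proof.
by move=> f0; apply: integral_ge0 => s _; rewrite lee_fin mulr_ge0 ?powR_ge0.
Qed.

Lemma integral_weight (f : R -> R) (u : int -> R) :
  measurable_fun [set: R] f -> (forall t, (0 <= f t)%R) ->
  (forall n, (0 <= u n)%R) ->
  \int[mu]_(t in [set: R]) (f t * u (Num.ceil t))%:E =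
  \esum_(n in [set: int]) ((u n)%:E * \int[mu]_(t in cell R n) (f t)%:E).
Proof.
move=> mf f0 u0; rewrite -(integral_ceil_mul (h := fun n => (u n)%:E)) //.
- by apply: eq_integral => t _; rewrite mulrC EFinM.
- exact/measurable_EFinP.
Qed.

Lemma integral_restrict_ceil (A : set int) (g : int -> R) (f : R -> R) :
  measurable_fun [set: R] f -> (forall t, (0 <= f t)%R) ->
  (forall n, (0 <= g n)%R) ->
  \int[mu]_(s in [set s : R | A (Num.ceil s)]) (g (Num.ceil s) * f s)%:E =
  \esum_(i in A) ((g i)%:E * \int[mu]_(s in cell R i) (f s)%:E).
Proof.
move=> mf f0 g0.
rewrite esum_mkcond integral_mkcond.
transitivity (\int[mu]_(s in [set: R])
    (f s * (if Num.ceil s \in A then g (Num.ceil s) else 0%R))%:E).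
  apply: eq_integral => s _; rewrite patchE.
  have -> : (s \in [set s : R | A (Num.ceil s)]) = (Num.ceil s \in A).
    by apply/idP/idP; rewrite !inE.
  by case: ifP => _; rewrite ?mulr0// mulrC.
rewrite (integral_weight (u := fun n => if n \in A then g n else 0%R))//.
  by apply: eq_esum => i _; case: ifP => //; rewrite mul0e.
by move=> n; case: ifP.
Qed.

(** Replacing the half-line [E t] by the union of all the cells that it meets makes
    the inner integral a function of the cell of [t], after which both
    integrals are sums. *)
Lemma function_of_sequence (K C : R) :
  (0 <= K)%R -> (0 <= C)%R ->
  (forall t s, E t s -> J (Num.ceil t) (Num.ceil s)) ->
  compressible p K k J v -> sequence_inequality p q k J v w C ->
  function_inequality p q k E v w (4 * K * C `^ p).
Proof.
move=> K0 C0 EJ kJ ineq f mf f0.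
pose F n := \int[mu]_(t in cell R n) (f t)%:E.
have F0 n : 0 <= F n by apply: integral_ge0 => t _; rewrite lee_fin.
rewrite integral_weight// pqE.
have c0 : (0 <= 4 * K * C `^ p)%R by rewrite !mulr_ge0 ?powR_ge0.
pose h n := (\esum_(i in J n) ((k i n `^ p)%:E * F i)) `^ (q / p) * (w n)%:E.
have h0 n : 0 <= h n by rewrite mule_ge0 ?poweR_ge0 ?lee_fin.
apply: (@le_trans _ _ ((\esum_(n in [set: int]) h n) `^ (q / p)^-1)); last first.
  rewrite -[leRHS](@poweRK_inv _ (q / p)) ?gt_eqF//; last first.
    rewrite mule_ge0 ?lee_fin// esum_ge0// => i _.
    by rewrite mule_ge0 ?lee_fin//; exact: F0.
  rewrite lee_poweR ?invr_gt0//; first by rewrite esum_ge0.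
  exact: power_inequality.
rewrite lee_poweR ?invr_gt0//.
  by apply: integral_ge0 => t _; rewrite mule_ge0 ?poweR_ge0 ?lee_fin.
have -> : \esum_(n in [set: int]) h n =
    \int[mu]_(t in [set: R]) (h (Num.ceil t) * cst 1 t).
  rewrite integral_ceil_mul//.
  by apply: eq_esum => n _; rewrite integral_cell1 mule1.
apply: le_integral_ge0 => t; first by rewrite mule_ge0 ?poweR_ge0 ?lee_fin.
rewrite /= mule1 lee_wpmul2r ?lee_fin// lee_poweR ?inner_ge0//.
rewrite -(integral_restrict_ceil _ mf f0) => [|n]; last exact: powR_ge0.
rewrite integral_mkcond [leRHS]integral_mkcond; apply: le_integral_ge0 => s.
  by rewrite patchE; case: ifP => // _; rewrite lee_fin mulr_ge0 ?powR_ge0.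
rewrite !patchE; case: ifPn => [/set_mem Es|_].
  by rewrite ifT// inE/=; exact: EJ.
by case: ifP => // _; rewrite lee_fin mulr_ge0 ?powR_ge0.
Qed.

(** The test function is [a n `^ p] on the part of the [n]-th cell in [P], and
    the outer integral is restricted to [Q].  For [t] in [Q], the half-line
    [E t] contains the part in [P] of all the cells indexed by [J], that of [t]
    included, so at most a factor 1/2 is lost on each integral. *)
Lemma sequence_of_function (P Q : set R) (C : R) :
  (p <= 1)%R -> (0 <= C)%R -> measurable P -> measurable Q ->
  (forall n, \int[mu]_(t in cell R n) (\1_P t)%:E = (2^-1)%:E) ->
  (forall n, \int[mu]_(t in cell R n) (\1_Q t)%:E = (2^-1)%:E) ->
  (forall t s, Q t -> P s -> J (Num.ceil t) (Num.ceil s) -> E t s) ->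
  function_inequality p q k E v w C ->
  sequence_inequality p q k J v w (2 `^ q^-1 * C `^ p^-1).
Proof.
move=> p1 C0 mP mQ halfP halfQ PQE ineq a a0.
pose x n := (a n `^ p)%R.
have x0 n : (0 <= x n)%R by exact: powR_ge0.
pose f (t : R) := (x (Num.ceil t) * \1_P t)%R.
have f0 t : (0 <= f t)%R by rewrite mulr_ge0.
have mf : measurable_fun [set: R] f.
  apply: measurable_funM; first exact: (measurable_ceil_comp x).
  exact: measurable_indic.
have Ff n : \int[mu]_(t in cell R n) (f t)%:E = (2^-1)%:E * (x n)%:E.
  transitivity (\int[mu]_(t in cell R n) ((x n)%:E * (\1_P t)%:E)).
    by apply: eq_integral => t /set_mem; rewrite cellE /= /f EFinM => ->.
  rewrite ge0_integralZl//; first by rewrite halfP muleC.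
  - exact: measurable_cell.
  - apply/measurable_EFinP; exact: measurable_indic.
  - by rewrite lee_fin.
pose Z := \esum_(i in [set: int]) (x i * v i)%:E.
have Z0 : 0 <= Z by apply: esum_ge0 => i _; rewrite lee_fin mulr_ge0.
pose B n := \esum_(i in J n) (k i n `^ p * x i)%:E.
have B0 n : 0 <= B n by apply: esum_ge0 => i _; rewrite lee_fin mulr_ge0 ?powR_ge0.
pose S := \esum_(n in [set: int]) (B n `^ (q / p) * (w n)%:E).
have S0 : 0 <= S by apply: esum_ge0 => n _; rewrite mule_ge0 ?poweR_ge0 ?lee_fin.
have := ineq f mf f0; rewrite integral_weight//.
have -> : \esum_(n in [set: int]) ((v n)%:E * \int[mu]_(t in cell R n) (f t)%:E) =
    (2^-1)%:E * Z.
  rewrite -ge0_esumZl//; last by move=> i; rewrite lee_fin mulr_ge0.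
  by apply: eq_esum => n _; rewrite Ff EFinM muleCA [(v n)%:E * _]muleC.
have BE t : Q t -> (2^-1)%:E * B (Num.ceil t) <=
    \int[mu]_(s in E t) (k (Num.ceil s) (Num.ceil t) `^ p * f s)%:E.
  move=> Qt.
  rewrite -ge0_esumZl//; last by move=> i; rewrite lee_fin mulr_ge0 ?powR_ge0.
  have -> : \esum_(i in J (Num.ceil t)) (2^-1%:E * (k i (Num.ceil t) `^ p * x i)%:E) =
      \esum_(i in J (Num.ceil t)) ((k i (Num.ceil t) `^ p)%:E *
        \int[mu]_(s in cell R i) (f s)%:E).
    by apply: eq_esum => i _; rewrite Ff EFinM muleCA.
  rewrite -(integral_restrict_ceil _ mf f0) => [|n]; last exact: powR_ge0.
  rewrite integral_mkcond [leRHS]integral_mkcond; apply: le_integral_ge0 => s.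
    by rewrite patchE; case: ifP => // _; rewrite lee_fin mulr_ge0 ?powR_ge0.
  rewrite !patchE; case: ifPn => [/set_mem/= Js|_]; last first.
    by case: ifP => // _; rewrite lee_fin mulr_ge0 ?powR_ge0.
  have [Ps|Ps] := pselect (P s).
    by rewrite ifT// inE; exact: PQE.
  by rewrite /f indicE memNset// !mulr0; case: ifP.
have lower : (2^-1 * 2^-1 `^ (q / p))%:E * S <=
    \int[mu]_(t in [set: R])
      ((\int[mu]_(s in E t)
          (k (Num.ceil s) (Num.ceil t) `^ p * f s)%:E) `^ (q / p)
       * (w (Num.ceil t))%:E).
  pose h n := ((2^-1)%:E * B n) `^ (q / p) * (w n)%:E.
  have h0 n : 0 <= h n by rewrite mule_ge0 ?poweR_ge0 ?lee_fin.
  apply: (@le_trans _ _ (\int[mu]_(t in [set: R]) (h (Num.ceil t) * (\1_Q t)%:E))).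
    rewrite integral_ceil_mul//.
    - rewrite -ge0_esumZl ?mulr_ge0 ?powR_ge0//; last first.
        by move=> n; rewrite mule_ge0 ?poweR_ge0 ?lee_fin.
      apply: le_esum => n _; rewrite halfQ /h poweRM ?lee_fin// poweR_EFin.
      by rewrite EFinM [in leRHS]muleC !muleA.
    - apply/measurable_EFinP; exact: measurable_indic.
  apply: le_integral_ge0 => t; first by rewrite mule_ge0 ?lee_fin.
  rewrite indicE; have [Qt|Qt] := pselect (Q t).
    rewrite mem_set// mule1 lee_wpmul2r ?lee_fin// lee_poweR ?BE//.
    by rewrite mule_ge0 ?lee_fin.
  by rewrite memNset// mule0 mule_ge0 ?poweR_ge0 ?lee_fin.
move=> bound.
have SZ : S <= 2%:E * (C%:E * Z) `^ (q / p).
  have {lower bound} : (2^-1 * 2^-1 `^ (q / p))%:E * S <=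
      (C%:E * ((2^-1)%:E * Z)) `^ (q / p).
    apply: le_trans lower _; rewrite -[X in _ `^ X]invf_div.
    apply/poweR_le_inv => //.
    - by apply: integral_ge0 => t _; rewrite mule_ge0 ?poweR_ge0 ?lee_fin.
    - by rewrite !mule_ge0 ?lee_fin.
  have -> : (C%:E * ((2^-1)%:E * Z)) `^ (q / p) =
      (2^-1 `^ (q / p))%:E * (C%:E * Z) `^ (q / p).
    by rewrite muleCA [LHS]poweRM ?mule_ge0 ?lee_fin// poweR_EFin.
  rewrite [(2^-1 * _)%R]mulrC EFinM -muleA lee_pmul2l ?lte_fin ?powR_gt0//.
  by rewrite lee_pdivrMl.
have qi0 : (0 < q^-1)%R by rewrite invr_gt0.
apply: (@le_trans _ _ (S `^ q^-1)).
  rewrite lee_poweR//.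
    by apply: esum_ge0 => n _; rewrite mule_ge0 ?poweR_ge0 ?lee_fin.
  apply: le_esum => n _; rewrite lee_wpmul2r ?lee_fin//.
  have qE (y : \bar R) : y `^ q = (y `^ p) `^ (q / p).
    by rewrite -poweRrM [(p * _)%R]mulrC divfK ?gt_eqF.
  rewrite qE.
  rewrite lee_poweR ?poweR_ge0//.
  apply: le_trans (poweR_esum_subadd _ p0 p1 _) _ => [i|]; first by rewrite mulr_ge0.
  by apply: le_esum => i _; rewrite lee_fin powRM.
apply: (le_trans (lee_poweR qi0 S0 SZ)).
rewrite poweRM ?lee_fin ?poweR_ge0// -poweRrM.
have -> : (q / p * q^-1 = p^-1)%R by rewrite mulrAC divff ?mul1r ?gt_eqF.
by rewrite poweRM ?lee_fin// !poweR_EFin EFinM muleA.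
Qed.
End transfer.

(** * Best constants and the theorem *)

Lemma best_constant_ge0 {R : realType} (P : R -> Prop) : (0 <= best_constant P)%E.
Proof. by apply: le_ereal_inf_tmp => _ [C [C0 _] <-]; rewrite lee_fin. Qed.

Lemma best_constant_le {R : realType} (P : R -> Prop) (C : R) :
  0 <= C -> P C -> (best_constant P <= C%:E)%E.
Proof. by move=> C0 PC; apply: ereal_inf_lbound; exists C. Qed.

Lemma best_constant_comparison {R : realType} (p K1 K2 : R) (D N : R -> Prop) :
  0 < p -> 0 < K1 -> 0 < K2 ->
  (forall C, 0 <= C -> D C -> N (K1 * C `^ p)) ->
  (forall C, 0 <= C -> N C -> D (K2 * C `^ p^-1)) ->
  ((exists C : R, 0 <= C /\ D C) <-> (exists C : R, 0 <= C /\ N C)) /\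
  ((K2^-1)%:E * best_constant D <= best_constant N `^ p^-1)%E /\
  (best_constant N `^ p^-1 <= (K1 `^ p^-1)%:E * best_constant D)%E.
Proof.
move=> p0 K10 K20 DN ND; have pi0 : 0 < p^-1 by rewrite invr_gt0.
split; [split=> -[C [C0 PC]]|split].
- by exists (K1 * C `^ p); split; [rewrite mulr_ge0 ?powR_ge0// ltW|exact: DN].
- by exists (K2 * C `^ p^-1); split; [rewrite mulr_ge0 ?powR_ge0// ltW|exact: ND].
- have l0 : (0 <= (K2^-1)%:E * best_constant D)%E.
    by rewrite mule_ge0 ?best_constant_ge0// lee_fin invr_ge0 ltW.
  apply/poweR_le_inv => //; first exact: best_constant_ge0.
  apply: le_ereal_inf_tmp => _ [C [C0 NC] <-].
  apply/poweR_le_inv => //; rewrite lee_pdivrMl// poweR_EFin -EFinM.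
  apply: best_constant_le; last exact: ND.
  by rewrite mulr_ge0 ?powR_ge0// ltW.
- have Kp0 : 0 < K1 `^ p^-1 by rewrite powR_gt0.
  rewrite -lee_pdivrMl//; apply: le_ereal_inf_tmp => _ [C [C0 DC] <-].
  have KC0 : 0 <= K1 * C `^ p by rewrite mulr_ge0 ?powR_ge0// ltW.
  rewrite lee_pdivrMl//.
  apply: le_trans (lee_poweR pi0 (best_constant_ge0 _)
    (best_constant_le KC0 (DN C C0 DC))) _.
  rewrite poweR_EFin powRM ?powR_ge0 ?(ltW K10)// -powRrM mulfV ?gt_eqF// powRr1//.
Qed.

Lemma step_fun1_ceil {R : realType} (u : int -> R) :
  step_fun1 u = (fun t : R => u (Num.ceil t)).
Proof. by apply/funext => t; rewrite step_fun1E. Qed.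

Lemma step_fun2_ceil {R : realType} (U : int -> int -> R) :
  step_fun2 U = (fun s t : R => U (Num.ceil s) (Num.ceil t)).
Proof. by apply/funext => s; apply/funext => t; rewrite step_fun2E. Qed.

Lemma continuous_lowerE {R : realType} (p q : R) U v w :
  continuous_lower p q U v w =
  function_inequality p q U (fun t => [set` `]-oo, t]%R]) v w.
Proof. by rewrite /continuous_lower step_fun2_ceil !step_fun1_ceil. Qed.

Lemma continuous_upperE {R : realType} (p q : R) U v w :
  continuous_upper p q U v w =
  function_inequality p q (fun i n => U n i) (fun t => [set` `[t, +oo[%R]) v w.
Proof. by rewrite /continuous_upper step_fun2_ceil !step_fun1_ceil. Qed.

Lemma half_cells_ordered {R : realType} (s t : R) :
  left_half s -> right_half t -> Num.ceil s <= Num.ceil t -> s < t.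
Proof.
rewrite /left_half /right_half /= => sl tr.
rewrite -(ler_int R); lra.
Qed.

Theorem theorem2p5 (R : realType) (p q c : R)
    (p_gt0 : 0 < p) (p_le1 : p <= 1) (q_gt0 : 0 < q) (c_gt0 : 0 < c) :
  exists c1 c2 : R, 0 < c1 /\ 0 < c2 /\
    forall (U : int -> int -> R) (v w : int -> R),
      regular_kernel c U ->
      (forall n, 0 <= v n) -> (forall n, 0 <= w n) ->
      (((exists C : R, 0 <= C /\ discrete_lower p q U v w C) <->
        (exists C' : R, 0 <= C' /\ continuous_lower p q U v w C')) /\
       (c1%:E * best_constant (discrete_lower p q U v w)
          <= best_constant (continuous_lower p q U v w) `^ p^-1)%E /\
       (best_constant (continuous_lower p q U v w) `^ p^-1
          <= c2%:E * best_constant (discrete_lower p q U v w))%E)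
      /\
      (((exists C : R, 0 <= C /\ discrete_upper p q U v w C) <->
        (exists C'' : R, 0 <= C'' /\ continuous_upper p q U v w C'')) /\
       (c1%:E * best_constant (discrete_upper p q U v w)
          <= best_constant (continuous_upper p q U v w) `^ p^-1)%E /\
       (best_constant (continuous_upper p q U v w) `^ p^-1
          <= c2%:E * best_constant (discrete_upper p q U v w))%E).
Proof.
pose K := compression_const p c.
have K0 : 0 < K by exact: compression_const_gt0.
have K10 : 0 < 4 * K by rewrite mulr_gt0.
have K20 : 0 < 2 `^ q^-1 :> R by rewrite powR_gt0.
exists (2 `^ q^-1)^-1, ((4 * K) `^ p^-1).
split; first by rewrite invr_gt0.
split; first by rewrite powR_gt0.
move=> U v w rU v0 w0; have [U0 _ _ _ _] := rU; split.
  rewrite continuous_lowerE; apply: best_constant_comparison => // C C0 H.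
    apply: (function_of_sequence (J := fun n => [set i | i <= n])) => //.
    - exact: ltW.
    - by move=> t s; rewrite /= in_itv/=; exact: le_ceil.
    - exact: lower_compressible.
  apply: (sequence_of_function (J := fun n => [set i | i <= n])) H => //.
  - exact: measurable_left_half.
  - exact: measurable_right_half.
  - exact: integral_left_half.
  - exact: integral_right_half.
  - by move=> t s Qt Ps /(half_cells_ordered Ps Qt) st; rewrite /= in_itv/= ltW.
rewrite continuous_upperE; apply: best_constant_comparison => // C C0 H.
  apply: (function_of_sequence (J := fun n => [set i | n <= i])) => //.
  - exact: ltW.
  - by move=> t s; rewrite /= in_itv/= andbT; exact: le_ceil.
  - exact: upper_compressible.
apply: (sequence_of_function (J := fun n => [set i | n <= i])) H => //.
- exact: measurable_right_half.
- exact: measurable_left_half.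
- exact: integral_right_half.
- exact: integral_left_half.
- by move=> t s Qt Ps /(half_cells_ordered Qt Ps) st; rewrite /= in_itv/= andbT ltW.
Qed.
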